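(* Let $n\ge 1$ and $m\ge 3$, and let $\lambda=(n,\dots,n)$ be the $m$-row rectangular shape ($m$ rows of length $n$). Let $M_\lambda=nT_{m-1}=n\binom{m}{2}$ be the maximum inversion number for shape $\lambda$. Then $$|S_{M_\lambda-2}(\lambda)|=\frac{(mn-2)(mn+1)}{2}.$$
   Context: A tableau of shape $\lambda$ is a bijective filling of the $m\times n$ array with $1,\dots,mn$; it is row-standard if entries increase left to right along each row. For a row-standard tableau $\tau$, a pair of entries $i<j$ in the same column is an inversion if either (1) $i$ or $j$ has no entry immediately to its right and $i$ lies below $j$, or (2) $i$ is immediately followed on its right by $i'$, $j$ is immediately followed on its right by $j'$, and $i'>j'$. $S_i(\lambda)$ is the set of row-standard tableaux of shape $\lambda$ with exactly $i$ inversions. $T_k=k(k+1)/2$ denotes the $k$-th triangular number. *)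

(* Defs.v *)
From mathcomp Require Export all_boot.

Set Implicit Arguments.
Unset Strict Implicit.
Unset Printing Implicit Defensive.

Section Tableaux.

Variables m n : nat.

(* Cell (r, c) is in row r (counted from the top) and column c (counted from
   the left); the value k : 'I_(m * n) encodes the entry k + 1. *)
Definition filling := {ffun 'I_m * 'I_n -> 'I_(m * n)}.

Definition entry (t : filling) (r : 'I_m) (c : 'I_n) : nat := (t (r, c)).+1.

Definition is_tableau (t : filling) : bool :=
  injectiveb t && [forall k, k \in codom t].

Definition row_standard (t : filling) : bool :=
  is_tableau t &&
  [forall r : 'I_m, forall c1 : 'I_n, forall c2 : 'I_n,
     (c1 < c2) ==> (entry t r c1 < entry t r c2)].

Definition right_entry (t : filling) (r : 'I_m) (c : 'I_n) : option nat :=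
  omap (entry t r) (insub c.+1).

(* The pair of entries i = entry t r1 c, j = entry t r2 c of column c; the
   condition i < j makes every unordered pair be counted at most once. *)
Definition inversion (t : filling) (c : 'I_n) (r1 r2 : 'I_m) : bool :=
  (entry t r1 c < entry t r2 c) &&
  match right_entry t r1 c, right_entry t r2 c with
  | Some i', Some j' => j' < i'
  | _, _ => r2 < r1
  end.

Definition inv (t : filling) : nat :=
  #|[set x : 'I_n * ('I_m * 'I_m) | inversion t x.1 x.2.1 x.2.2]|.

Definition S_ (i : nat) : {set filling} :=
  [set t : filling | row_standard t && (inv t == i)].

Definition max_inv : nat := \max_(t : filling | row_standard t) inv t.

End Tableaux.

Definition triangular (k : nat) : nat := (k * k.+1) %/ 2.

(* Main.v *)
Require Import Defs.
From mathcomp Require Import all_boot zify.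

Set Implicit Arguments.
Unset Strict Implicit.
Unset Printing Implicit Defensive.

(** Record a row-standard tableau as the word whose k-th letter is the row
    containing k, and place the entries from the largest to the smallest. Order
    the rows by decreasing number of free cells, breaking ties by the last entry
    placed (smallest first) and initially from top to bottom. Placing an entry in
    the row of rank p creates exactly p pairs that are not inversions and of which
    it is the larger element, so a tableau amounts to a sequence of ranks, each
    below the current number of non-full rows, and [n * 'C(m, 2) - inv] is the sum
    of the ranks. As long as that sum is small the shape stays almost balanced:
    with K free cells left, rank 1 is allowed iff K >= 2 and rank 2 iff K >= 3.
    Hence the sequences of sum 2 consist of two 1's among mn - 1 places, or one 2
    among mn - 2 places. *)

(** * Positions of the successive occurrences of a letter in a word *)

Section Positions.
Variable T : eqType.
Implicit Types (s x : T) (w : seq T).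

(** Occurrences are numbered from 0, like columns, so that in a row word occurrence [c] of the
    letter [r] sits at the value of cell [(r, c)]. With too few occurrences the result is
    [size w]. *)
Fixpoint pos s (c : nat) w : nat :=
  if w is x :: w' then
    if x == s then (if c is c'.+1 then (pos s c' w').+1 else 0)
    else (pos s c w').+1
  else 0.

Lemma pos_size s c w : c < count_mem s w -> pos s c w < size w.
Proof.
elim: w c => [|x w IH] c //=; case: eqP => _ /=; last by rewrite add0n; exact: IH.
by case: c => [|c] //; rewrite add1n !ltnS; exact: IH.
Qed.

Lemma nth_pos x0 s c w : c < count_mem s w -> nth x0 w (pos s c w) = s.
Proof.
elim: w c => [|x w IH] c //=; case: eqP => [->|_] /=; last exact: IH.
by case: c => [|c] //=; rewrite add1n ltnS; exact: IH.
Qed.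

Lemma pos_take s c w k :
  c < count_mem s w -> (pos s c w < k) = (c < count_mem s (take k w)).
Proof.
elim: w c k => [|x w IH] c [|k] //=; case: eqP => _ /=.
  by case: c => [|c] //; rewrite !add1n !ltnS; exact: IH.
by rewrite !add0n ltnS; exact: IH.
Qed.

Lemma pos_ltn s c1 c2 w :
  c1 < c2 -> c2 < count_mem s w -> pos s c1 w < pos s c2 w.
Proof.
elim: w c1 c2 => [|x w IH] c1 c2 //=; case: eqP => _ /=; last exact: IH.
by case: c2 c1 => [|c2] [|c1] //; rewrite add1n !ltnS; exact: IH.
Qed.

Lemma pos_catl s c w1 w2 :
  c < count_mem s w1 -> pos s c (w1 ++ w2) = pos s c w1.
Proof.
elim: w1 c => [|x w IH] c //=; case: eqP => _ /=; last by move=> h; rewrite IH.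
by case: c => [|c] //; rewrite add1n ltnS => h; rewrite IH.
Qed.

Lemma pos_catr s c w1 w2 :
  pos s (count_mem s w1 + c) (w1 ++ w2) = size w1 + pos s c w2.
Proof. by elim: w1 => [|x w IH] //=; case: eqP => _ /=; rewrite ?add0n IH. Qed.

Lemma pos_index s w : s \in w -> pos s 0 w = index s w.
Proof.
by elim: w => [|x w IH] //=; rewrite inE eq_sym; case: eqP => //= _ /IH ->.
Qed.

Lemma pos_count_take x0 w k : k < size w ->
  pos (nth x0 w k) (count_mem (nth x0 w k) (take k w)) w = k.
Proof.
elim: w k => [|x w IH] [|k] //=; first by rewrite eqxx.
by rewrite ltnS => /IH; case: eqP => _ /= ->.
Qed.

Lemma count_mem_take_lt x0 w k : k < size w ->
  count_mem (nth x0 w k) (take k w) < count_mem (nth x0 w k) w.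
Proof.
move=> h; have := drop_nth x0 h; move: (nth x0 w k) => s e.
rewrite -{2}(cat_take_drop k w) count_cat e /= eqxx; lia.
Qed.

End Positions.

(** * Finite counting *)

(** By pigeonhole, an injection of [A] into the integers below [#|A|] hits each of them exactly
    once. *)
Lemma card_fiber_rank (T : finType) (A : {pred T}) (f : T -> nat) (e : nat) :
  {in A &, injective f} -> {in A, forall x, f x < #|A|} ->
  #|[pred x in A | f x == e]| = (e < #|A|).
Proof.
move=> injf ltf.
have u : uniq (map f (enum A)).
  by rewrite map_inj_in_uniq ?enum_uniq // => x y; rewrite !mem_enum; exact: injf.
have sub : {subset map f (enum A) <= iota 0 #|A|}.
  by move=> _ /mapP[x + ->]; rewrite mem_enum mem_iota => /ltf.
have sz : size (iota 0 #|A|) <= size (map f (enum A)).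
  by rewrite size_iota size_map -cardE.
have [_ eqm] := uniq_min_size u sub sz.
have -> : e < #|A| = (e \in map f (enum A)) by rewrite eqm mem_iota.
rewrite -count_uniq_mem // count_map cardE /enum_mem -size_filter -filter_predI.
by congr (size _); apply: eq_filter => x; rewrite /= !inE andbC.
Qed.

(** Trichotomy splits [T * T] into [L], its mirror image [G] and the diagonal [D]. *)
Lemma card_ltn_pairs (T : finType) (f : T -> nat) : injective f ->
  #|[set p : T * T | f p.1 < f p.2]| = 'C(#|T|, 2).
Proof.
move=> injf; set L := [set p : T * T | f p.1 < f p.2].
pose G := [set p : T * T | f p.2 < f p.1].
pose D := [set p : T * T | p.1 == p.2].
have eqG : #|G| = #|L|.
  pose sw (p : T * T) := (p.2, p.1).
  have sw_inj : injective sw by move=> [a b] [c d] [-> ->].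
  rewrite -(card_imset (mem L) sw_inj); apply: eq_card => -[a b].
  apply/idP/imsetP => [|[[c d]] + [-> ->]]; last by rewrite !inE.
  by rewrite !inE /= => h; exists (b, a) => //; rewrite inE.
have eqD : #|D| = #|T|.
  have d_inj : injective (fun x : T => (x, x)) by move=> a b [].
  rewrite -(card_imset T d_inj); apply: eq_card => -[a b].
  apply/idP/imsetP => [|[c _ [-> ->]]]; last by rewrite inE.
  by rewrite inE /= => /eqP->; exists b.
have tot : #|L| + #|G| + #|D| = #|T| * #|T|.
  rewrite -card_prod -!sum1_card.
  rewrite [RHS](bigID (mem D)) /= [X in _ = _ + X](bigID (mem L)) /=.
  rewrite addnC; congr (_ + _).
  congr (_ + _); apply: eq_bigl => -[a b]; rewrite !inE /=.
    by case: eqP => [->|]; rewrite ?ltnn.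
  by rewrite -(inj_eq injf); case: ltngtP.
rewrite bin2; move: tot; rewrite eqG eqD; case: #|T| => [|k] /=; lia.
Qed.

Lemma big_tuple_cons (T : finType) k (F : seq T -> nat) :
  \sum_(u : k.+1.-tuple T) F u = \sum_(v : k.-tuple T) \sum_(r : T) F (r :: v).
Proof.
rewrite pair_big /=.
rewrite (reindex (fun p : k.-tuple T * T => cons_tuple p.2 p.1)) //=.
exists (fun u : k.+1.-tuple T => (behead_tuple u, thead u)) => [[v r] _|u _] /=.
  by congr (_, _); apply: val_inj.
by rewrite [RHS]tuple_eta.
Qed.

(** * The order on rows and the rank of a row *)

Section Rank.
Variable m : nat.
Implicit Types (s r : 'I_m) (u v : seq 'I_m).

Definition mult r u : nat := count_mem r u.

Lemma mult_cons r x u : mult r (x :: u) = (x == r) + mult r u.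
Proof. by []. Qed.

Definition prec u s r :=
  (mult s u < mult r u) ||
  ((mult s u == mult r u) && (index s u < index r u)).

Definition rank u r := #|[pred s | prec u s r]|.

Lemma prec_irr u r : prec u r r = false.
Proof. by rewrite /prec !ltnn andbF. Qed.

Lemma prec_trans u : transitive (prec u).
Proof. rewrite /prec => y x z; lia. Qed.

Lemma prec_total u s r : r \in u -> s != r -> prec u s r || prec u r s.
Proof.
rewrite /prec => ru neq.
have : index s u != index r u.
  apply: contra neq => /eqP e; rewrite -(nth_index s ru) -e nth_index //.
  by rewrite -index_mem e index_mem.
lia.
Qed.

Lemma prec_rank u s r : prec u s r -> rank u s < rank u r.
Proof.
move=> h; apply: proper_card; apply/properP; split.
  by apply/subsetP => x; rewrite !inE => /prec_trans; apply.
by exists s; rewrite !inE // prec_irr.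
Qed.

Lemma rank_inj u : (forall r, r \in u) -> injective (rank u).
Proof.
move=> full s r e; apply/eqP; apply: contraT => /(prec_total (full r)).
by case/orP => /prec_rank; rewrite e ltnn.
Qed.

Lemma rank0_min u r s : rank u r = 0 -> mult r u <= mult s u.
Proof.
move=> /card0_eq /(_ s); rewrite !inE /prec; lia.
Qed.

End Rank.

Arguments mult : simpl never.

(** * Words, their defect, and the choices for the next letter *)

Section Words.
Variables m n : nat.
Implicit Types (r s : 'I_m) (v : seq 'I_m).

(* The appended letters play the role of a column n whose entries increase
   downwards; with them, clause (1) of the definition of inversions becomes an
   instance of clause (2). *)
Definition ext v := v ++ enum 'I_m.

Fixpoint defect v : nat :=
  if v is r :: v' then rank (ext v') r + defect v' else 0.

Definition fits v := [forall r, mult r v <= n].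

Definition avail v := #|[pred r | mult r v < n]|.

(** A word of length [k] is a partial filling by the [k] largest entries; letting [k] vary makes a
    recurrence possible. *)
Definition words (k d : nat) := \sum_(v : k.-tuple 'I_m) (fits v && (defect v == d) : nat).

Lemma mem_ext v r : r \in ext v.
Proof. by rewrite mem_cat mem_enum orbT. Qed.

Lemma mult_enum r : mult r (enum 'I_m) = 1.
Proof. by rewrite /mult count_uniq_mem ?enum_uniq // mem_enum. Qed.

Lemma mult_ext v r : mult r (ext v) = (mult r v).+1.
Proof. by rewrite /mult count_cat -/(mult r (enum _)) mult_enum addn1. Qed.

Lemma fits_cons r v : fits (r :: v) = fits v && (mult r v < n).
Proof.
apply/forallP/andP => [h|[/forallP h hr] s] /=.
  split; last by have := h r; rewrite mult_cons eqxx.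
  by apply/forallP => s; apply: leq_trans (h s); rewrite mult_cons leq_addl.
by rewrite mult_cons; have := h s; case: (eqVneq r s) => [<-|].
Qed.

(** A row preceding a non-full row has at least as many free cells, so it is non-full too. Hence the
    ranks of non-full rows lie below [avail v], and being distinct they fill that interval. *)
Lemma rank_avail v (e : nat) :
  #|[pred r | (mult r v < n) && (rank (ext v) r == e)]| = (e < avail v).
Proof.
rewrite -(@card_fiber_rank _ _ (rank (ext v))) //; last first.
  move=> r; rewrite inE => hr; rewrite /avail (cardD1 r) inE hr add1n ltnS.
  apply: subset_leq_card; apply/subsetP => s.
  rewrite !inE /prec !mult_ext; case: (eqVneq s r) => [->|_] /=.
    by rewrite !ltnn andbF.
  by case/orP=> [|/andP[/eqP[->]]] //; rewrite ltnS => /ltn_trans; apply.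
by move=> r s _ _; apply: rank_inj => x; exact: mem_ext.
Qed.

(** Extending [v] to defect [d] forces the rank [d - defect v] of the new letter; exactly one row
    has it if it is below [avail v], and none otherwise. *)
Lemma words_rec k (d : nat) : words k.+1 d =
  \sum_(v : k.-tuple 'I_m)
     ([&& fits v, defect v <= d & d - defect v < avail v] : nat).
Proof.
rewrite /words (big_tuple_cons _ (fun v => fits v && (defect v == d) : nat)).
apply: eq_bigr => v _.
under eq_bigr => r _ do rewrite fits_cons /=.
case: (fits v) => /=; last by rewrite big1.
case: (leqP (defect v) d) => /= [le|lt].
  rewrite -rank_avail -sum1_card [RHS]big_mkcond /=.
  apply: eq_bigr => r _; rewrite inE /=.
  have -> : (rank (ext v) r == d - defect v) = (rank (ext v) r + defect v == d).
    by rewrite -{2}(subnK le) eqn_add2r.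
  by case: (_ && _).
rewrite big1 // => r _; case: eqP => [e|]; last by rewrite andbF.
by move: lt; rewrite -e ltnNge leq_addl.
Qed.

Lemma sum_mult v : \sum_(r : 'I_m) mult r v = size v.
Proof.
elim: v => [|x v IH] /=; first by rewrite big1.
under eq_bigr => r _ do rewrite mult_cons.
rewrite big_split /= IH (bigD1 x) //= eqxx big1 // => r.
by rewrite eq_sym => /negPf->.
Qed.

Lemma sum_room v : fits v ->
  \sum_(r : 'I_m) (n - mult r v) = m * n - size v.
Proof.
move=> /forallP h.
have : \sum_(r : 'I_m) (n - mult r v) + \sum_r mult r v = m * n.
  rewrite -big_split /=; under eq_bigr => r _ do rewrite subnK //.
  by rewrite sum_nat_const card_ord.
rewrite sum_mult; lia.
Qed.

Lemma fits_full v : size v = m * n -> fits v -> forall r, mult r v = n.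
Proof.
move=> sz /[dup] h /sum_room; rewrite sz subnn => /eqP.
rewrite sum_nat_eq0 => /forallP /= e r.
by apply/eqP; rewrite eqn_leq (forallP h r) -subn_eq0 (eqP (e r)).
Qed.

(** * Balance of the partial shape and the number of non-full rows *)

Definition balanced v := forall r s, mult r v <= (mult s v).+1.

(** This is what survives one placement of rank 1: whenever a row has two free cells, some other row
    still has one. *)
Definition near_balanced v :=
  forall r, exists2 s, s != r & mult s v <= (mult r v).+1.

(** Each entry goes to a row with the fewest filled cells, which keeps the counts within 1 of each
    other. *)
Lemma defect0_balanced v : defect v = 0 -> balanced v.
Proof.
elim: v => [|x v IH] //= /eqP; rewrite addn_eq0 => /andP[/eqP rk /eqP /IH bal] r s.
rewrite !mult_cons.
have := rank0_min s rk; rewrite !mult_ext => le.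
by have := bal r s; case: (eqVneq x r) => [<-|_]; case: (x == s); lia.
Qed.

Lemma exists_other (hm : 3 <= m) r s : exists x, (x != r) && (x != s).
Proof.
apply/existsP; apply: contraT; rewrite negb_exists => /forallP h.
suff : #|'I_m| <= 2 by rewrite card_ord leqNgt hm.
apply: leq_trans (_ : #|[set r; s]| <= _); last by rewrite cards2; case: eqP.
apply: subset_leq_card; apply/subsetP => x _.
by move: (h x); rewrite !inE negb_and !negbK.
Qed.

Lemma defect1_near_balanced (hm : 3 <= m) v : defect v <= 1 -> near_balanced v.
Proof.
elim: v => [|x v IH] /=.
  by move=> _ r; have [s /andP[? _]] := exists_other hm r r; exists s.
(* At rank 0 the row [x] was minimal in [v]: it is the witness for every other row, and its own
   witness comes from induction. *)
case: (posnP (rank (ext v) x)) => [rk|rk] le r.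
  have mn s := rank0_min s rk.
  case: (eqVneq x r) => [<-|neq].
    have [|s ns les] := IH _ x; first by move: le; rewrite rk.
    by exists s => //; rewrite !mult_cons eq_sym (negPf ns) /= eqxx; lia.
  exists x => //; rewrite !mult_cons eqxx (negPf neq).
  by have := mn r; rewrite !mult_ext; lia.
(* At rank 1 the defect is used up, so [v] is balanced. A third row, distinct from [r] and [x], is
   unchanged and serves as witness; this is where [3 <= m] enters. *)
have bal : balanced v by apply: defect0_balanced; lia.
have [s /andP[sr sx]] := exists_other hm r x.
by exists s => //; rewrite !mult_cons eq_sym (negPf sx); have := bal s r; lia.
Qed.

Lemma avail_gt0 v : fits v -> (0 < avail v) = (size v < m * n).
Proof.
move=> fv; have H := sum_room fv.
apply/idP/idP => [/card_gt0P[r]|lt].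
  by rewrite inE => hr; move: H; rewrite (bigD1 r) //=; lia.
apply/card_gt0P; apply/existsP; apply: contraT; rewrite negb_exists => /forallP h.
move: H; rewrite big1 => [|r _]; last by have := h r; rewrite inE; lia.
lia.
Qed.

Lemma avail_tail v : fits v -> (forall r, n <= (mult r v).+1) ->
  avail v = m * n - size v.
Proof.
move=> fv h; rewrite -sum_room // /avail -sum1_card big_mkcond /=.
by apply: eq_bigr => r _; rewrite inE; have := h r; case: ltnP; lia.
Qed.

Lemma avail_le v : fits v -> avail v <= m * n - size v.
Proof.
move=> fv; rewrite -sum_room // /avail -sum1_card big_mkcond /=.
by apply: leq_sum => r _; rewrite inE; case: ltnP; lia.
Qed.

Lemma avail_gt1 (hm : 3 <= m) v : fits v -> defect v <= 1 ->
  (1 < avail v) = (size v + 1 < m * n).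
Proof.
move=> fv dv; apply/idP/idP => [|lt]; first by have := avail_le fv; lia.
(* If each row has at most one free cell, non-full rows and free cells are equally many. Otherwise a
   row with two free cells and its near-balance witness are both non-full. *)
case: (boolP [forall r, n <= (mult r v).+1]) => [/forallP h|].
  by rewrite avail_tail //; lia.
rewrite negb_forall => /existsP[r]; rewrite -ltnNge => hr.
have [s sr hs] := defect1_near_balanced hm dv r.
rewrite /avail (cardD1 r) (cardD1 s) !inE sr /=; lia.
Qed.

Lemma avail_gt2 (hm : 3 <= m) v : fits v -> defect v = 0 ->
  (2 < avail v) = (size v + 2 < m * n).
Proof.
move=> fv dv; apply/idP/idP => [|lt]; first by have := avail_le fv; lia.
case: (boolP [forall r, n <= (mult r v).+1]) => [/forallP h|].
  by rewrite avail_tail //; lia.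
rewrite negb_forall => /existsP[r]; rewrite -ltnNge => hr.
(* By balance, one row with two free cells leaves at least one in every row. *)
suff -> : avail v = m by [].
rewrite -[RHS]card_ord; apply: eq_card => s; rewrite !inE.
have := defect0_balanced dv s r; lia.
Qed.

(** * Recurrences and counts for defects 0, 1 and 2 *)

Lemma words_small (d : nat) : words 0 d = (d == 0).
Proof.
rewrite /words (big_pred1 [tuple]); last first.
  by move=> u; apply/esym/eqP; exact: tuple0.
rewrite /= eq_sym; have -> // : fits [::] by apply/forallP.
Qed.

Lemma words0_rec k : words k.+1 0 = (k < m * n) * words k 0.
Proof.
rewrite words_rec /words big_distrr /=; apply: eq_bigr => v _.
case fv: (fits v); rewrite ?muln0 //= leqn0 sub0n.
by rewrite avail_gt0 // size_tuple; case: eqP; case: ltnP.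
Qed.

Lemma words1_rec (hm : 3 <= m) k :
  words k.+1 1 = (k < m * n) * words k 1 + (k + 1 < m * n) * words k 0.
Proof.
rewrite words_rec /words !big_distrr -big_split /=; apply: eq_bigr => v _.
case fv: (fits v); rewrite ?muln0 //=.
have g0 := avail_gt0 fv; have g1 := avail_gt1 hm fv.
move: g0 g1; rewrite size_tuple.
by case: (defect v) => [|[|d]] g0 g1 /=; rewrite ?subn0 ?subnn ?g0 ?g1 //; lia.
Qed.

Lemma words2_rec (hm : 3 <= m) k :
  words k.+1 2 = (k < m * n) * words k 2 + (k + 1 < m * n) * words k 1
               + (k + 2 < m * n) * words k 0.
Proof.
rewrite words_rec /words !big_distrr -!big_split /=; apply: eq_bigr => v _.
case fv: (fits v); rewrite ?muln0 //=.
have g0 := avail_gt0 fv; have g1 := avail_gt1 hm fv.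
have g2 := avail_gt2 hm fv; move: g0 g1 g2; rewrite size_tuple.
by case: (defect v) => [|[|[|d]]] g0 g1 g2 /=; rewrite ?subn0 ?subnn ?g0 ?g1 ?g2 //; lia.
Qed.

Lemma words0 k : k <= m * n -> words k 0 = 1.
Proof.
by elim: k => [|k IH] lt; rewrite ?words_small // words0_rec lt IH // ltnW.
Qed.

Lemma words1 (hm : 3 <= m) k : k < m * n -> words k 1 = k.
Proof.
elim: k => [|k IH] lt; rewrite ?words_small // words1_rec // IH ?words0; lia.
Qed.

(** In this range at least three cells are free before each placement, so ranks 1 and 2 are always
    allowed: ['C(k, 2)] words use two 1's and [k] use one 2. *)
Lemma words2 (hm : 3 <= m) k : k + 2 <= m * n -> 2 * words k 2 = k * k.+1.
Proof.
elim: k => [|k IH] lt; rewrite ?words_small // words2_rec //.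
rewrite words1 ?words0; lia.
Qed.

Lemma words2_total (hm : 3 <= m) (hn : 1 <= n) :
  words (m * n) 2 = ((m * n - 2) * (m * n + 1)) %/ 2.
Proof.
have hN : 3 <= m * n by nia.
(* The closed form holds up to [K = m * n - 2]. Of the last two placements, the first allows only
   ranks 0 and 1 and the second only 0, giving [K * K.+1 / 2 + K]. *)
have [K e] : exists K, m * n = K.+2 by exists (m * n - 2); lia.
have w2 : 2 * words K 2 = K * K.+1 by apply: words2 => //; rewrite e addn2.
have -> : words (m * n) 2 = words K.+2 2 by rewrite e.
rewrite !words2_rec // !words0 ?words1 ?e; lia.
Qed.

End Words.

(** * The correspondence between words and row-standard tableaux *)

Section Reading.
Variables m n : nat.
Local Notation N := (m * n).
Variable k0 : 'I_N.
Implicit Types (r s : 'I_m) (v : N.-tuple 'I_m).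

(* The default k0 is never used when every letter occurs n times in v. *)
Definition tab v : filling m n := 
  [ffun x : 'I_m * 'I_n => insubd k0 (pos x.1 x.2 v)].

Section Tab.
Variable v : N.-tuple 'I_m.
Hypothesis cv : forall r, count_mem r v = n.

Lemma tabE r (c : 'I_n) : tab v (r, c) = pos r c v :> nat.
Proof.
rewrite ffunE /= val_insubd; have -> // : pos r c v < N.
by rewrite -[X in _ < X](size_tuple v) pos_size // cv.
Qed.

Lemma tnth_tab r (c : 'I_n) : tnth v (tab v (r, c)) = r.
Proof. by rewrite (tnth_nth r) tabE nth_pos // cv. Qed.

Lemma tab_surj k : {c : 'I_n | tab v (tnth v k, c) = k}.
Proof.
have hk : k < size v by rewrite size_tuple.
have hc := count_mem_take_lt (tnth v k) hk.
rewrite -(tnth_nth (tnth v k)) cv in hc.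
exists (Ordinal hc); apply: val_inj; rewrite [LHS]tabE /=.
have := pos_count_take (tnth v k) hk.
by rewrite -(tnth_nth (tnth v k)).
Qed.

Lemma tab_row_standard : row_standard (tab v).
Proof.
have mono r (c1 c2 : 'I_n) : c1 < c2 -> tab v (r, c1) < tab v (r, c2).
  by move=> lt; rewrite !tabE pos_ltn // cv.
apply/andP; split; last first.
  apply/forallP => r; apply/forallP => c1; apply/forallP => c2.
  by apply/implyP => lt; rewrite /entry ltnS mono.
apply/andP; split.
  apply/injectiveP => -[r c] [s d] e.
  have ers : r = s by rewrite -(tnth_tab r c) e tnth_tab.
  move: e; rewrite -ers => e; congr (_, _); apply: val_inj.
  case: (ltngtP c d) => // /(mono r); by rewrite e ltnn.
apply/forallP => k; apply/codomP.
by have [c e] := tab_surj k; exists (tnth v k, c); rewrite e.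
Qed.

Local Notation E r c := (pos r c (ext v)).

Lemma count_mem_ext r : count_mem r (ext v) = n.+1.
Proof. by rewrite -/(mult r (ext v)) mult_ext /mult cv. Qed.

Lemma right_tab r (c : 'I_n) : right_entry (tab v) r c =
  if c.+1 < n then Some (E r c.+1).+1 else None.
Proof.
rewrite /right_entry; case: insubP => [d lt e|/negPf ->] //=.
by rewrite lt /entry tabE e pos_catl // cv.
Qed.

(** Occurrence [n] of [r] is the appended one, so the virtual column [n] is ordered like the
    rows. *)
Lemma pos_last r : E r n = N + r.
Proof.
rewrite -{1}(cv r) -[count_mem r v]addn0 pos_catr size_tuple.
by rewrite pos_index ?mem_enum // index_enum_ord.
Qed.

Lemma inversion_tab (c : 'I_n) r s : inversion (tab v) c r s =
  (E r c < E s c) && (E s c.+1 < E r c.+1).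
Proof.
have eE x : pos x c v = E x c by rewrite pos_catl // cv.
rewrite /inversion /entry ltnS !tabE !eE; congr (_ && _).
rewrite !right_tab; case: ltnP => [_|le]; first by rewrite ltnS.
have -> : c.+1 = n by apply/eqP; rewrite eqn_leq le ltn_ord.
by rewrite !pos_last ltn_add2l.
Qed.

(* When the entry k = E r c is placed, the rows preceding r are those forming
   with it a non-inversion whose larger entry is k. *)
Lemma prec_tab r s (c : 'I_n) :
  prec (drop (E r c).+1 (ext v)) s r =
  (E s c < E r c) && (E s c.+1 < E r c.+1).
Proof.
set k := E r c; set w := ext v.
have hc x : c < count_mem x w by rewrite count_mem_ext ltnW // ltnS.
have hc1 x : c.+1 < count_mem x w by rewrite count_mem_ext ltnS.
have split_w x : count_mem x (take k.+1 w) + count_mem x (drop k.+1 w) = n.+1.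
  by rewrite -count_cat cat_take_drop count_mem_ext.
have lt_rc : k < pos r c.+1 w by rewrite pos_ltn.
have lt_sc : pos s c w < pos s c.+1 w by rewrite pos_ltn.
have tk x d : d < count_mem x w ->
    (pos x d w < k.+1) = (d < count_mem x (take k.+1 w)) by exact: pos_take.
(* Position [k] is occurrence [c] of [r], so the prefix ending there contains exactly [c.+1] copies
   of [r]. *)
have cr : count_mem r (take k.+1 w) = c.+1.
  apply/eqP; rewrite eqn_leq -(tk r c) // ltnSn andbT leqNgt.
  by rewrite -(tk r c.+1) // ltnS -ltnNge.
(* In a tie, the next copy of [x] is its first one in the suffix, so comparing indices there
   compares the positions of occurrence [c.+1]. *)
have idx x : count_mem x (take k.+1 w) = c.+1 ->
    pos x c.+1 w = k.+1 + index x (drop k.+1 w).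
  move=> e; have := split_w x; rewrite e => e2.
  have xin : x \in drop k.+1 w.
    by rewrite -has_pred1 has_count -(ltn_add2l c.+1) e2 addn0 ltnS.
  rewrite -pos_index // -{1}(cat_take_drop k.+1 w) -[c.+1]addn0 -e pos_catr.
  by rewrite size_takel // pos_size.
have ks : (pos s c w == k) = (s == r).
  apply/eqP/eqP => [e|->] //.
  by rewrite -(nth_pos r (hc s)) e (nth_pos r (hc r)).
have := tk s c (hc s); have := tk s c.+1 (hc1 s).
have := split_w s; have := split_w r; rewrite cr /prec /mult.
have := idx r cr; have := idx s.
rewrite -/k; case: (eqVneq s r) ks => [-> _|_].
  by rewrite !ltnn andbF.
move: (count_mem s (take _ _)) (count_mem s (drop _ _)) => a b.
move: (count_mem r (drop _ _)) => d.
move: (index s _) (index r _) lt_rc lt_sc; rewrite -/w -/k.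
move: (pos s c w) (pos s c.+1 w) (pos r c.+1 w) => x y z i j.
move=> lt1 lt2 neq es er e1 e2 e3 e4.
have {es} : a == c.+1 -> y = k.+1 + i by move/eqP.
have : c < n by [].
lia.
Qed.

Lemma defect_sum (u : seq 'I_m) x0 :
  defect u = \sum_(0 <= k < size u) rank (drop k.+1 (ext u)) (nth x0 u k).
Proof.
elim: u => [|x u IH] /=; first by rewrite big_nil.
by rewrite big_nat_recl //= drop0 IH.
Qed.

(** The sum of ranks over positions is reindexed by cells and regrouped by columns, where [prec_tab]
    reads each rank as a number of non-inversions. *)
Lemma defect_tab : defect v =
  \sum_(c < n) #|[set p | (E p.1 c < E p.2 c) && (E p.1 c.+1 < E p.2 c.+1)]|.
Proof.
have /andP[/andP[/injectiveP inj _] _] := tab_row_standard.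
have bij : bijective (tab v).
  by apply: inj_card_bij inj _; rewrite card_prod !card_ord.
(* A default letter for [nth]: the existence of [k0] forces [m] to be positive. *)
have x0 : 'I_m by case: m k0 => [|m'] k1; [case: k1 | exact: ord0].
rewrite (defect_sum v x0) size_tuple big_mkord (reindex (tab v)) /=; last first.
  exact: onW_bij.
transitivity (\sum_(r < m) \sum_(c < n) rank (drop (tab v (r, c)).+1 (ext v)) r).
  rewrite pair_bigA; apply: eq_bigr => -[r c] _ /=.
  by rewrite -tnth_nth tnth_tab.
rewrite exchange_big /=; apply: eq_bigr => c _.
transitivity (\sum_(r < m) \sum_(s < m | (E s c < E r c) && (E s c.+1 < E r c.+1)) 1).
  apply: eq_bigr => r _; rewrite /rank sum1_card; apply: eq_card => s.
  rewrite !inE unfold_in -prec_tab tabE.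
  by rewrite -(@pos_catl _ r c v (enum 'I_m)) ?cv.
rewrite (exchange_big_dep xpredT) //= pair_big_dep /= -sum1_card.
by apply: eq_bigl => -[s r]; rewrite inE.
Qed.

(** In each column, the pairs ordered by that column split according to their order in the next one,
    into inversions and non-inversions, ['C(m, 2)] in all. *)
Lemma inv_tab : Defs.inv (tab v) + defect v = n * 'C(m, 2).
Proof.
have -> : Defs.inv (tab v) =
    \sum_(c < n) #|[set p | (E p.1 c < E p.2 c) && (E p.2 c.+1 < E p.1 c.+1)]|.
  rewrite /Defs.inv -sum1_card.
  under [RHS]eq_bigr => c _ do rewrite -sum1_card.
  rewrite (pair_big_dep xpredT) /=; apply: eq_bigl => -[c [r s]].
  by rewrite !inE inversion_tab.
rewrite defect_tab -big_split /=.
have -> : n * 'C(m, 2) = \sum_(c < n) 'C(m, 2).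
  by rewrite sum_nat_const card_ord.
apply: eq_bigr => c _.
have injE d : d <= n -> injective (fun r => E r d).
  move=> hd r s /= e.
  have hr x : d < count_mem x (ext v) by rewrite count_mem_ext ltnS.
  by rewrite -(nth_pos r (hr r)) e (nth_pos r (hr s)).
have := card_ltn_pairs (injE c (ltnW (ltn_ord c))); rewrite card_ord => <-.
rewrite -[RHS](cardsID [set p | E p.2 c.+1 < E p.1 c.+1]).
congr (_ + _); apply: eq_card => -[r s]; rewrite !inE //= [RHS]andbC.
case: (eqVneq r s) => [->|neq]; first by rewrite !ltnn.
have := inj_eq (injE c.+1 (ltn_ord c)) r s; rewrite (negPf neq).
by case: (ltngtP (E r c.+1)); rewrite // andbC.
Qed.

End Tab.

Lemma tab_inj v1 v2 : (forall r, count_mem r v1 = n) ->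
  (forall r, count_mem r v2 = n) -> tab v1 = tab v2 -> v1 = v2.
Proof.
move=> c1 c2 e; apply: eq_from_tnth => k.
have [c ec] := tab_surj c1 k.
by rewrite -{2}ec e tnth_tab.
Qed.

Lemma tab_onto (t : filling m n) : row_standard t ->
  exists2 v : N.-tuple 'I_m, (forall r, count_mem r v = n) & tab v = t.
Proof.
case/andP => /andP[/injectiveP inj /forallP surj] /forallP mono.
pose row k := (iinv (surj k)).1.
have rowE r c : row (t (r, c)) = r.
  by have := inj _ _ (f_iinv (surj (t (r, c)))); rewrite /row => ->.
pose v : N.-tuple 'I_m := [tuple row k | k < N].
(* Prefix counts of the row word count the small entries of a row; in the induction step only the
   row containing the value [k] gains a cell. *)
have cnt_take r k : k <= N ->
    count_mem r (take k v) = #|[pred c : 'I_n | t (r, c) < k]|.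
  elim: k => [|k IH] hk; first by rewrite take0 eq_card0.
  have hs : k < size v by rewrite size_tuple.
  have vk : nth r v k = row (Ordinal hk).
    by rewrite -(tnth_mktuple row) (tnth_nth r).
  rewrite (take_nth r hs) -cats1 count_cat IH; last exact: ltnW.
  rewrite vk /= addn0 -(cardID [pred c | t (r, c) < k] [pred c | _ < k.+1]).
  congr (_ + _).
    by apply: eq_card => c; rewrite !inE ltnS; case: ltngtP.
  have [x tx] : exists x, t x = Ordinal hk.
    by exists (iinv (surj (Ordinal hk))); rewrite f_iinv.
  case: x tx => s d tx; rewrite -tx rowE; case: (eqVneq s r) => [<-|neq].
    rewrite (@eq_card1 _ d) // => c; rewrite !inE ltnS -leqNgt -eqn_leq.
    have -> : (k == t (s, c) :> nat) = (t (s, c) == t (s, d)) by rewrite tx eq_sym.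
    by rewrite (inj_eq inj) xpair_eqE eqxx.
  rewrite eq_card0 // => c; rewrite !inE ltnS -leqNgt -eqn_leq.
  have -> : (k == t (r, c) :> nat) = (t (r, c) == t (s, d)) by rewrite tx eq_sym.
  by rewrite (inj_eq inj) xpair_eqE eq_sym (negPf neq).
have cv r : count_mem r v = n.
  rewrite -[X in count _ X](take_size v) size_tuple cnt_take //.
  by rewrite -[RHS]card_ord; apply: eq_card => c; rewrite !inE ltn_ord.
exists v => //; apply/ffunP => -[r c]; apply: val_inj; rewrite /= tabE //.
have hk : t (r, c) < size v by rewrite size_tuple.
rewrite -[RHS](pos_count_take r hk) -tnth_nth tnth_mktuple rowE.
congr pos; rewrite cnt_take; last exact: ltnW.
have lt_mono (c1 c2 : 'I_n) : c1 < c2 -> t (r, c1) < t (r, c2).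
  by move: (mono r) => /forallP/(_ c1)/forallP/(_ c2)/implyP h /h.
(* Since rows increase, the entries of row [r] smaller than that of column [c] are those to its
   left. *)
transitivity #|[pred d : 'I_n | d < c]|.
  by rewrite -sum1_card -(big_ord_widen _ (fun=> 1) (ltnW (ltn_ord c))) sum1_card card_ord.
apply: eq_card => d; rewrite !inE; apply/idP/idP => [/lt_mono //|].
by apply: contraTT; rewrite -!leqNgt leq_eqVlt => /orP[/eqP/val_inj->|/lt_mono/ltnW].
Qed.

Lemma fits_countP v : reflect (forall r, count_mem r v = n) (fits n v).
Proof.
apply: (iffP idP) => [h r|h]; last by apply/forallP => r; rewrite /mult h.
exact: fits_full (size_tuple v) h r.
Qed.

(** [tab] matches words of defect [i] with these tableaux, by [inv_tab]; the bound on [i] keeps the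
    truncated subtraction exact. *)
Lemma card_S_ i : i <= n * 'C(m, 2) ->
  #|S_ m n (n * 'C(m, 2) - i)| = words m n N i.
Proof.
move=> le; pose A := [set v : N.-tuple 'I_m | fits n v && (defect v == i)].
have -> : words m n N i = #|A|.
  rewrite -sum1_card /words [RHS]big_mkcond /=.
  by apply: eq_bigr => v _; rewrite inE; case: (_ && _).
have <- : #|tab @: A| = #|A|.
  apply: card_in_imset => v1 v2; rewrite !inE.
  by move=> /andP[/fits_countP c1 _] /andP[/fits_countP c2 _]; exact: tab_inj.
apply: eq_card => t; apply/idP/imsetP.
  rewrite inE => /andP[/tab_onto[v cv <-] /eqP e]; exists v => //.
  rewrite inE; apply/andP; split; first exact/fits_countP.
  by move: (inv_tab cv); rewrite e; lia.
case=> v; rewrite inE => /andP[/fits_countP cv /eqP e] ->.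
rewrite inE tab_row_standard //=; move: (inv_tab cv); rewrite e; lia.
Qed.

(** The bound is [inv_tab]; it is attained by the tableau of the word of defect 0. *)
Lemma max_inv_rect : max_inv m n = n * 'C(m, 2).
Proof.
apply/eqP; rewrite eqn_leq; apply/andP; split.
  apply/bigmax_leqP => t /tab_onto[v cv <-].
  by rewrite -(inv_tab cv) leq_addr.
have : 0 < #|S_ m n (n * 'C(m, 2) - 0)| by rewrite card_S_ // words0.
case/card_gt0P => t; rewrite inE subn0 => /andP[rs /eqP <-].
exact: leq_bigmax_cond.
Qed.

End Reading.

Theorem theorem4p2 (m n : nat) (hn : 1 <= n) (hm : 3 <= m) :
  let M := n * triangular m.-1 in
  [/\ M = n * 'C(m, 2),
      M = max_inv m n &
      #|S_ m n (M - 2)| = ((m * n - 2) * (m * n + 1)) %/ 2].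
Proof.
have hN : 0 < m * n by rewrite muln_gt0 hn (leq_trans _ hm).
have tri : triangular m.-1 = 'C(m, 2).
  by rewrite /triangular bin2 -divn2 prednK ?(leq_trans _ hm) // mulnC.
rewrite /= tri (max_inv_rect (Ordinal hN)) (card_S_ (Ordinal hN)) //.
  by split=> //; exact: words2_total.
(* The side condition of [card_S_] at 2: [2 <= 'C(3, 2) <= 'C(m, 2) <= n * 'C(m, 2)]. *)
by rewrite (leq_trans (_ : 2 <= 'C(3, 2))) // (leq_trans (leq_bin2l 2 hm)) // leq_pmull.
Qed.
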